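(* Let $G = C_{n_1}\square C_{n_2}\square\cdots\square C_{n_k}$ be the Cartesian product of $k$ cycles, where $k\geq 2$, $n_i\neq n_j$ for $i\neq j$, and $n_i\geq 5$ for all $i\in\{1,\dots,k\}$. Then $\rho'(G)=2$ and $\rho(G)=3$.
   Context: $C_n$ is the cycle on $n$ vertices and $\square$ is the Cartesian product of graphs. A vertex (or edge) coloring of a graph is distinguishing if no automorphism other than the identity preserves it. $D(G)$ (resp. $D'(G)$) is the least number of colors in a distinguishing vertex (resp. edge) coloring of $G$. When $D(G)=2$, the cost of distinguishing $\rho(G)$ is the minimum number of vertices in the smaller color class over all distinguishing vertex colorings of $G$ with two colors. When $D'(G)=2$, the cost of edge-distinguishing $\rho'(G)$ is the minimum number of edges in the smaller color class over all distinguishing edge colorings of $G$ with two colors. *)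

(* Defs.v *)
From mathcomp Require Import all_boot all_fingroup.

Set Implicit Arguments.
Unset Strict Implicit.
Unset Printing Implicit Defensive.

Record sgraph := SGraph {
  vertex :> finType;
  adj : rel vertex;
  adj_sym : symmetric adj;
  adj_irr : irreflexive adj }.

Section Cycle.
Variable n : nat.

(* The guard [i != j] only matters for [n = 1]; this is the cycle on [n]
   vertices for [n >= 3]. *)
Definition cycle_adj : rel 'I_n :=
  fun i j => (i != j) && ((j == ordS i) || (i == ordS j)).

Lemma cycle_adj_sym : symmetric cycle_adj.
Proof. by move=> i j; rewrite /cycle_adj eq_sym orbC. Qed.

Lemma cycle_adj_irr : irreflexive cycle_adj.
Proof. by move=> i; rewrite /cycle_adj eqxx. Qed.

Definition cycle_graph : sgraph := SGraph cycle_adj_sym cycle_adj_irr.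
End Cycle.

Section CartesianProduct.
Variables (I : finType) (G : I -> sgraph).

Definition cart_adj : rel {dffun forall i, G i} :=
  fun x y => [exists i, adj (x i) (y i) && [forall j, (j != i) ==> (x j == y j)]].

Lemma cart_adj_sym : symmetric cart_adj.
Proof.
move=> x y; rewrite /cart_adj; apply: eq_existsb => i; rewrite adj_sym.
by congr (_ && _); apply: eq_forallb => j; rewrite [x j == _]eq_sym.
Qed.

Lemma cart_adj_irr : irreflexive cart_adj.
Proof. by move=> x; apply/existsP => -[i]; rewrite adj_irr. Qed.

Definition cart_prod : sgraph := SGraph cart_adj_sym cart_adj_irr.
End CartesianProduct.

Section Distinguishing.
Variable G : sgraph.

Definition edges : {set {set G}} :=
  [set [set p.1; p.2] | p : G * G & adj p.1 p.2].

Definition automorphism (s : {perm G}) : Prop :=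
  forall x y, adj (s x) (s y) = adj x y.

(* Colorings need not be proper. An edge coloring is a function on all sets of
   vertices; only its values on [edges] are ever used. *)
Definition vertex_distinguishing d (c : G -> 'I_d) : Prop :=
  forall s : {perm G}, automorphism s -> (forall x, c (s x) = c x) -> s = 1%g.

Definition edge_distinguishing d (c : {set G} -> 'I_d) : Prop :=
  forall s : {perm G}, automorphism s ->
    (forall e, e \in edges -> c (s @: e) = c e) -> s = 1%g.

Definition is_least (P : nat -> Prop) (m : nat) : Prop :=
  P m /\ forall m', P m' -> m <= m'.

(* [is_D d], [is_D' d], [is_rho m] and [is_rho' m] stand for D(G) = d,
   D'(G) = d, rho(G) = m and rho'(G) = m. Relations are used because D' need
   not exist (e.g. for K_2), and rho and rho' are only defined when D = 2 and
   D' = 2, respectively. *)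
Definition is_D : nat -> Prop :=
  is_least (fun d => exists c : G -> 'I_d, vertex_distinguishing c).

Definition is_D' : nat -> Prop :=
  is_least (fun d => exists c : {set G} -> 'I_d, edge_distinguishing c).

Definition is_rho (m : nat) : Prop :=
  is_D 2 /\
  is_least (fun r => exists2 c : G -> 'I_2, vertex_distinguishing c &
    r = minn #|[set x | c x == ord0]| #|[set x | c x == ord_max]|) m.

Definition is_rho' (m : nat) : Prop :=
  is_D' 2 /\
  is_least (fun r => exists2 c : {set G} -> 'I_2, edge_distinguishing c &
    r = minn #|[set e in edges | c e == ord0]|
             #|[set e in edges | c e == ord_max]|) m.

End Distinguishing.

(* Main.v *)
(** Since no [n_i] is 3 or 4, two neighbors of [x] have [x] as their only common
    neighbor iff they lie on opposite sides of [x] on the same coordinate cycle.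
    So an automorphism maps coordinate cycles to coordinate cycles, of the same
    length, hence (the [n_i] being distinct) in the same direction. It therefore
    acts coordinatewise, by a rotation or a reflection in each coordinate, and
    is trivial on a coordinate as soon as it fixes two consecutive values.

    For any [x] and [y], reflecting every coordinate exchanges [x] and [y], so no
    set of at most two vertices and no single edge has a trivial stabilizer. But
    the vertices [(0,0,0,...)], [(0,1,0,...)], [(1,1,1,...)], and the two edges
    [(0,0,0,...)--(1,0,0,...)] and [(2,0,1,...)--(2,1,1,...)], have a trivial
    set stabilizer. As color classes of distinguishing 2-colorings are never
    smaller than these bounds, the other class needs no separate count. *)

Require Import Defs.
From mathcomp Require Import all_boot all_fingroup zify.

Set Implicit Arguments.
Unset Strict Implicit.
Unset Printing Implicit Defensive.

(** * Rotations and reflections of a single cycle *)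

Section CycleShift.
Variable n : nat.
Implicit Types (b : bool) (u v w : 'I_n).

(** The boolean is a sense of rotation, [~~ b] being the opposite one, so both senses share their
    proofs. *)
Definition shift b : 'I_n -> 'I_n := if b then @ordS n else @ord_pred n.

Lemma shiftK b : cancel (shift b) (shift (~~ b)).
Proof. by case: b; [exact: ordSK | exact: ord_predK]. Qed.

Lemma shiftNK b : cancel (shift (~~ b)) (shift b).
Proof. by move: (@shiftK (~~ b)); rewrite negbK. Qed.

Lemma iter_ordS m v : val (iter m (@ordS n) v) = (v + m) %% n.
Proof.
elim: m => [|m IH] /=; first by rewrite addn0 modn_small.
by rewrite IH -addn1 modnDml addn1 addnS.
Qed.

Lemma iter_shiftK b m : cancel (iter m (shift b)) (iter m (shift (~~ b))).
Proof. by elim: m => // m IH v; rewrite iterSr /= shiftK IH. Qed.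

Lemma iter_shift_id b m v : (iter m (shift b) v == v) = (n %| m).
Proof.
have H w : (iter m (@ordS n) w == w) = (n %| m).
  rewrite -val_eqE iter_ordS -[X in _ == X](modn_small (ltn_ord w)).
  by rewrite -[X in _ == X %[mod _]]addn0 eqn_modDl mod0n.
case: b; first exact: H.
rewrite -(H (iter m (shift false) v)) -[in RHS]/(shift true).
by rewrite (@iter_shiftK false) eq_sym.
Qed.

Lemma ordS_reach u v : exists m, v = iter m (@ordS n) u.
Proof.
exists (v + (n - u)); apply: val_inj; rewrite iter_ordS.
have -> : u + (v + (n - u)) = v + n by have := ltn_ord u; lia.
by rewrite modnDr modn_small.
Qed.

(* The reflection exchanging [u] and [v]; adding [n] avoids truncation. *)
Definition refl_subproof u v w : (u + v + n - w) %% n < n.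
Proof. by rewrite ltn_mod; have := ltn_ord u; lia. Qed.

Definition refl u v w : 'I_n := Ordinal (refl_subproof u v w).

(** Turns the remainders in [refl] into case distinctions that [lia] can decide. *)
Lemma modn3 a : a < 3 * n ->
  a %% n = if a < n then a else if a < 2 * n then a - n else a - 2 * n.
Proof.
move=> a3; case: ifP => a1; first by rewrite modn_small.
case: ifP => a2.
  have -> : a = a - n + n by lia.
  rewrite modnDr modn_small; lia.
have -> : a = a - 2 * n + n + n by lia.
rewrite !modnDr modn_small; lia.
Qed.

Lemma refl_swapl u v : refl u v u = v.
Proof.
apply: val_inj => /=; have [? ?] := (ltn_ord u, ltn_ord v).
by rewrite modn3; do ?case: ifP; lia.
Qed.

Lemma reflK u v : involutive (refl u v).
Proof.
move=> w; apply: val_inj => /=; have [[]] := (ltn_ord u, ltn_ord v, ltn_ord w) => ? ? ?.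
rewrite (@modn3 (u + v + n - w)); last by lia.
by rewrite modn3; do ?case: ifP; lia.
Qed.

Lemma refl_ordS u v w : refl u v (ordS w) = ord_pred (refl u v w).
Proof.
apply: val_inj => /=; have [[]] := (ltn_ord u, ltn_ord v, ltn_ord w) => ? ? ?.
rewrite (@modn3 w.+1); last by lia.
rewrite (@modn3 (u + v + n - w)); last by lia.
by do ?case: ifP => ?; rewrite !modn3; do ?case: ifP; lia.
Qed.

Lemma refl_shift u v b w : refl u v (shift b w) = shift (~~ b) (refl u v w).
Proof.
case: b => /=; first exact: refl_ordS.
by rewrite -{2}(ord_predK w) refl_ordS ord_predK.
Qed.

Hypothesis n5 : 5 <= n.

Lemma shift_iter_neq b m v : 0 < m < 5 -> iter m (shift b) v <> v.
Proof.
move=> /andP[m0 m5] /eqP; rewrite iter_shift_id => /dvdn_leq; lia.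
Qed.

Lemma shift_neq b v : shift b v != v.
Proof. by apply/eqP; apply: (@shift_iter_neq b 1). Qed.

Lemma shift_inv_neq b v : shift (~~ b) v != shift b v.
Proof.
apply/eqP => /(congr1 (shift b)); rewrite shiftNK => /esym.
exact: (@shift_iter_neq b 2).
Qed.

Lemma cycle_adjP u v : cycle_adj u v <-> exists b, v = shift b u.
Proof.
rewrite /cycle_adj; split => [/andP[_ /orP[] /eqP ->]|[b ->]].
- by exists true.
- by exists false; rewrite /= ordSK.
rewrite eq_sym shift_neq; case: b => /=; first by rewrite eqxx.
by rewrite ord_predK eqxx orbT.
Qed.

(** The two vertices are three steps apart, so an edge between them would close a rotation by 4 or
    by 2, impossible for [5 <= n]. *)
Lemma shift2_nadj b v : ~~ cycle_adj (shift b (shift b v)) (shift (~~ b) v).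
Proof.
apply/negP => /cycle_adjP [c]; case: (eqVneq c b) => [-> | ].
  by move/(congr1 (shift b)); rewrite shiftNK => /esym; apply: (@shift_iter_neq b 4).
have -> : (c != b) = (c == ~~ b) by case: b c => [] [].
move=> /eqP->; rewrite shiftK => /(congr1 (shift b)); rewrite shiftNK => /esym.
exact: (@shift_iter_neq b 2).
Qed.

Lemma refl_adj u v w w' : cycle_adj w w' -> cycle_adj (refl u v w) (refl u v w').
Proof.
by move/cycle_adjP => [b ->]; apply/cycle_adjP; exists (~~ b); apply: refl_shift.
Qed.

End CycleShift.

(** * Coordinates, unit steps and opposite neighbors in a product of cycles *)

Section CycleProduct.
Variables (I : finType) (n : I -> nat).
Hypothesis n5 : forall i, 5 <= n i.

Local Notation torus := (cart_prod (fun i => cycle_graph (n i))).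
Implicit Types (x y z w : torus) (s : {perm torus}) (b c : bool).

Definition coord x (i : I) : 'I_(n i) :=
  (x : {dffun forall i, cycle_graph (n i)}) i.

Definition point (f : forall i, 'I_(n i)) : torus :=
  [ffun i => f i : cycle_graph (n i)].

Lemma coord_point f i : coord (point f) i = f i.
Proof. by rewrite /coord ffunE. Qed.

Lemma coord_inj x y : (forall i, coord x i = coord y i) -> x = y.
Proof. by move=> H; apply/ffunP. Qed.

Definition step b i x : torus := point (dfwith (coord x) (shift b (coord x i))).

Lemma coord_step b i x : coord (step b i x) i = shift b (coord x i).
Proof. by rewrite coord_point dfwith_in. Qed.

Lemma coord_step_out b i j x : i != j -> coord (step b i x) j = coord x j.
Proof. by move=> ij; rewrite coord_point dfwith_out. Qed.

Lemma stepK b i : cancel (step b i) (step (~~ b) i).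
Proof.
move=> x; apply: coord_inj => j; case: (eqVneq i j) => [<-|ij].
  by rewrite !coord_step shiftK.
by rewrite !coord_step_out.
Qed.

Lemma adj_coordP x y : adj x y <->
  exists i, cycle_adj (coord x i) (coord y i) /\
            forall j, j != i -> coord x j = coord y j.
Proof.
split.
  move=> /existsP[i /andP[a /forallP H]]; exists i; split => // j ji.
  by have := H j; rewrite ji /= => /eqP.
move=> [i [a H]]; apply/existsP; exists i; apply/andP; split => //.
by apply/forallP => j; apply/implyP => ji; apply/eqP; apply: H.
Qed.

Lemma adjP x y : adj x y <-> exists i b, y = step b i x.
Proof.
rewrite adj_coordP; split => [[i [/cycle_adjP-/(_ (n5 i))[b E] H]]|[i [b ->]]].
  exists i, b; apply: coord_inj => j; case: (eqVneq i j) => [<-|ij].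
    by rewrite coord_step.
  by rewrite coord_step_out // H // eq_sym.
exists i; split; first by apply/cycle_adjP => //; exists b; rewrite coord_step.
by move=> j ji; rewrite coord_step_out // eq_sym.
Qed.

Lemma coord_iter_step b i m x :
  coord (iter m (step b i) x) i = iter m (shift b) (coord x i).
Proof. by elim: m => //= m IH; rewrite coord_step IH. Qed.

Lemma coord_iter_step_out b i j m x : i != j ->
  coord (iter m (step b i) x) j = coord x j.
Proof. by move=> ij; elim: m => //= m IH; rewrite coord_step_out. Qed.

Lemma iter_step_id b i m x : (iter m (step b i) x == x) = (n i %| m).
Proof.
apply/eqP/idP => [E|].
  by rewrite -(@iter_shift_id _ b m (coord x i)) -coord_iter_step E.
rewrite -(@iter_shift_id _ b m (coord x i)) -coord_iter_step => /eqP E.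
apply: coord_inj => j; case: (eqVneq i j) => [<- //|ij].
exact: coord_iter_step_out.
Qed.

Lemma step_neq b i x : step b i x != x.
Proof.
apply/eqP => /(congr1 (coord^~ i)); rewrite coord_step => /eqP.
by rewrite (negbTE (shift_neq _ _ _)).
Qed.

Lemma step_inj b c i j x : step b i x = step c j x -> i = j /\ b = c.
Proof.
move=> E; have ij : i = j.
  apply/eqP/negP => /negP ij; have := congr1 (coord^~ i) E.
  rewrite coord_step coord_step_out 1?eq_sym // => /eqP.
  by rewrite (negbTE (shift_neq _ _ _)).
subst j; split => //; have := congr1 (coord^~ i) E; rewrite !coord_step.
case: b c {E} => [] [] // /eqP.
  by rewrite eq_sym (negbTE (shift_inv_neq _ true _)).
by rewrite (negbTE (shift_inv_neq _ true _)).
Qed.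

(** Expresses that [y] and [z] are opposite neighbors of [x] by adjacency alone, so that
    automorphisms preserve it. *)
Definition straight x y z :=
  [/\ y != z, adj x y, adj x z & forall w, adj w y -> adj w z -> w = x].

Lemma step_straight b i x : straight x (step b i x) (step (~~ b) i x).
Proof.
split; [|by apply/adjP; exists i, b|by apply/adjP; exists i, (~~ b)|].
  by apply/eqP => /step_inj [_]; case: b.
move=> w; rewrite adj_sym => /adjP[j [c ->]].
case: (eqVneq i j) => [<-|ij].
  (* Within direction [i], turning back gives [x], while going on leads three steps away from the
     other neighbor. *)
  case: (eqVneq c b) => [->|cb]; last first.
    by have -> : c = ~~ b; [case: b c cb => [] []|rewrite stepK].
  move=> /adj_coordP [j' [a H]]; case: (eqVneq i j') => [E|ij'].
    by subst j'; move: a; rewrite !coord_step (negbTE (shift2_nadj _ _ _)).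
  have := H i ij'; rewrite !coord_step => /(congr1 (shift b)).
  by rewrite shiftNK => /(@shift_iter_neq _ (n5 i) b 3 _ isT).
(* A step in a direction [j] other than [i] leaves [w] different from the other neighbor in both
   coordinates. *)
move=> /adj_coordP [j' [a H]].
have ij' : i = j'.
  apply/eqP/negP => /negP ij'; have := H i ij'.
  rewrite coord_step_out 1?eq_sym // !coord_step => /eqP.
  by rewrite eq_sym (negbTE (shift_inv_neq _ b _)).
have := H j; rewrite -ij' eq_sym ij => /(_ isT).
rewrite coord_step !coord_step_out // => /eqP.
by rewrite (negbTE (shift_neq _ _ _)).
Qed.

(** Neighbors in two different directions span a square, whose fourth corner is a second common
    neighbor. *)
Lemma straight_step x y z : straight x y z ->
  exists i b, y = step b i x /\ z = step (~~ b) i x.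
Proof.
case=> yz /adjP[i [b Ey]] /adjP[j [c Ez]] H; exists i, b; split => //.
case: (eqVneq i j) => [E|ij].
  subst j; rewrite Ez; congr step; apply/eqP; move: yz; rewrite Ey Ez.
  by case: b c {Ey Ez} => [] []; rewrite ?eqxx.
have C : step c j y = step b i z.
  rewrite Ey Ez; apply: coord_inj => h.
  case: (eqVneq i h) => [<-|ih].
    by rewrite coord_step !(coord_step, coord_step_out) // eq_sym.
  case: (eqVneq j h) => [<-|jh].
    by rewrite coord_step !(coord_step, coord_step_out) // eq_sym.
  by rewrite !coord_step_out.
have E : step c j y = x.
  by apply: H; rewrite adj_sym; apply/adjP; [exists j, c | exists i, b].
have := congr1 (coord^~ j) E; rewrite coord_step Ey coord_step_out // => /eqP.
by rewrite (negbTE (shift_neq _ _ _)).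
Qed.

(** * Automorphisms act coordinatewise *)

Section Automorphism.
Hypothesis n_inj : injective n.
Variable s : {perm torus}.
Hypothesis auts : automorphism s.

Lemma aut_straight x y z : straight x y z -> straight (s x) (s y) (s z).
Proof.
case=> yz xy xz H; split; rewrite ?auts ?(inj_eq perm_inj) // => w.
rewrite -(permKV s w) !auts => wy wz; congr (s _); exact: H.
Qed.

(** The first and third of three successive points of a line are opposite neighbors of the second,
    and so are their images; two image points thus determine the third. *)
Lemma aut_step2 b c i j x : s (step b i x) = step c j (s x) ->
  s (step b i (step b i x)) = step c j (step c j (s x)).
Proof.
move=> E; have := aut_straight (step_straight b i (step b i x)).
rewrite stepK E => /straight_step [h [d [E1 E2]]].
move: (E2); rewrite -{1}(stepK c j (s x)) => /step_inj [jh cd].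
by rewrite E1 -jh; congr step; case: c d cd {E E1 E2} => [] [].
Qed.

Lemma aut_iter_step b c i j m x : s (step b i x) = step c j (s x) ->
  s (iter m (step b i) x) = iter m (step c j) (s x).
Proof.
move=> E; suff [] : s (iter m (step b i) x) = iter m (step c j) (s x) /\
  s (iter m.+1 (step b i) x) = iter m.+1 (step c j) (s x) by [].
elim: m => [//|m [IH1 IH2]]; split => //=.
by rewrite -IH1; apply: aut_step2; rewrite IH1.
Qed.

(* The image of a line is a line of the same period, and the period [n i] of a
   line determines its direction [i]. *)
Lemma aut_step b i x : exists c, s (step b i x) = step c i (s x).
Proof.
have /adjP[j [c E]] : adj (s x) (s (step b i x)).
  by rewrite auts; apply/adjP; exists i, b.
suff ij : i = j by exists c; rewrite E ij.
have H m : (n i %| m) = (n j %| m).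
  rewrite -(iter_step_id b i m x) -(iter_step_id c j m (s x)).
  by rewrite -(aut_iter_step m E) (inj_eq perm_inj).
apply: n_inj; apply/eqP; rewrite eqn_dvd -H dvdnn.
by rewrite H dvdnn.
Qed.

Lemma aut_coord_step b i j x : j != i ->
  coord (s (step b j x)) i = coord (s x) i.
Proof. by move=> ji; have [c ->] := aut_step b j x; rewrite coord_step_out. Qed.

(** [x] and [y] are joined by steps in directions other than [i], none of which changes coordinate
    [i] of the image. *)
Lemma aut_coord x y i : coord x i = coord y i -> coord (s x) i = coord (s y) i.
Proof.
move=> xyi.
(* Induction on the number of coordinates where [x] and [y] differ; each round corrects one of
   them. *)
elim: {x}_.+1 {-2}x (ltnSn #|[set j | coord x j != coord y j]|) xyi => // m IH x.
rewrite ltnS => D xyi.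
case: (set_0Vmem [set j | coord x j != coord y j]) => [E|[j]].
  congr (coord (s _) i); apply: coord_inj => j; apply/eqP/negbFE.
  by have := in_set0 j; rewrite -E inE.
rewrite inE => xyj.
have ji : j != i by apply: contraNneq xyj => ->; rewrite xyi.
have [p Ep] := ordS_reach (coord x j) (coord y j).
have <- : coord (s (iter p (step true j) x)) i = coord (s x) i.
  by elim: p {Ep} => //= p IHp; rewrite aut_coord_step.
apply: IH; last by rewrite coord_iter_step_out.
apply: leq_trans D; apply: proper_card; apply/properP; split.
  apply/subsetP => h; rewrite !inE; case: (eqVneq j h) => [<- //|jh].
  by rewrite coord_iter_step_out.
by exists j; rewrite !inE ?xyj // coord_iter_step Ep eqxx.
Qed.

Lemma aut_coord_shift x i : exists b, forall m y,
  coord y i = iter m (@ordS _) (coord x i) ->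
  coord (s y) i = iter m (shift b) (coord (s x) i).
Proof.
have [b E] := aut_step true i x; exists b => m y Ey.
rewrite -coord_iter_step -(aut_iter_step m E); apply: aut_coord.
by rewrite coord_iter_step.
Qed.

(** Fixing one value pins down the offset of the rotation or reflection; fixing the next value
    excludes the reversed sense. *)
Lemma aut_coord_fix x y i : coord y i = ordS (coord x i) ->
  coord (s x) i = coord x i -> coord (s y) i = coord y i ->
  forall z, coord (s z) i = coord z i.
Proof.
move=> xy sx sy z; have [b H] := aut_coord_shift x i.
have := H 1 y xy; rewrite sy sx xy /= => E.
have [m Em] := ordS_reach (coord x i) (coord z i).
rewrite (H m z Em) sx Em; congr iter.
case: b E {H} => // /eqP; by rewrite eq_sym (negbTE (shift_inv_neq _ true _)).
Qed.

End Automorphism.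

(** * Reflections exchanging two vertices, and facts on two-colorings and small sets *)

Lemma swap_automorphism x y : 0 < #|I| ->
  exists s, [/\ automorphism s, s x = y, s y = x & s <> 1%g].
Proof.
move=> /card_gt0P [i _].
pose f z := point (fun j => refl (coord x j) (coord y j) (coord z j)).
have fK : involutive f.
  by move=> z; apply: coord_inj => j; rewrite !coord_point reflK ?n5.
have fadj z w : adj z w -> adj (f z) (f w).
  move=> /adj_coordP [j [a H]]; apply/adj_coordP; exists j; split.
    by rewrite !coord_point; apply: refl_adj a.
  by move=> h hj; rewrite !coord_point H.
have fx : f x = y by apply: coord_inj => j; rewrite coord_point refl_swapl.
exists (perm (inv_inj fK)); split; rewrite ?permE //.
- move=> z w; rewrite !permE; apply/idP/idP; last exact: fadj.
  by move/fadj; rewrite !fK.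
- by rewrite -fx fK.
(* If [f] were the identity, then [x = y]; but reflection about [x] exchanges the two neighbors of
   [x] in direction [i]. *)
move=> s1; have {s1} f1 z : f z = z by rewrite -(permE (inv_inj fK)) s1 perm1.
have xy : x = y by rewrite -fx f1.
have := congr1 (coord^~ i) (f1 (step true i x)).
rewrite coord_point coord_step refl_shift // -xy refl_swapl => /eqP.
by rewrite (negbTE (shift_inv_neq _ true _)).
Qed.

Lemma imset2 s x y : s @: [set x; y] = [set s x; s y].
Proof. by rewrite imsetU !imset_set1. Qed.

Lemma imset_edges s e : automorphism s -> e \in edges torus -> s @: e \in edges torus.
Proof.
move=> auts /imsetP[[x y] /= xy ->]; rewrite imset2.
apply/imsetP; exists (s x, s y) => //.
by move: xy; rewrite !inE -[cart_adj _ _]/(adj x y) -auts.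
Qed.

Lemma step_edge b i x : [set x; step b i x] \in edges torus.
Proof.
by apply/imsetP; exists (x, step b i x); rewrite // inE; apply/adjP; exists i, b.
Qed.

Lemma ord_lt2_eq d (u v : 'I_d) : d < 2 -> u = v.
Proof. by move=> d2; apply: val_inj; case: u v => [u ?] [v ?] /=; lia. Qed.

(** With two colors, invariance of a single class already gives invariance of the coloring. *)
Lemma ord2_eq (a u v : 'I_2) : (u == a) = (v == a) -> u = v.
Proof. by case: a u v => [[|[|//]] ?] [[|[|//]] ?] [[|[|//]] ?] // _; apply: val_inj. Qed.

Lemma set_le2 (S : finType) (A : {set S}) (z : S) : #|A| <= 2 ->
  exists x y : S, A = set0 \/ A = [set x; y].
Proof.
(* [z] is a default value for the empty set; a singleton is taken as a pair with [x = y]. *)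
case: (set_0Vmem A) => [->|[x xA]] A2; first by exists z, z; left.
case: (set_0Vmem (A :\ x)) => [E|[y yA]].
  by exists x, x; right; rewrite setUid -(setD1K xA) E setU0.
exists x, y; right; apply/esym/eqP; rewrite eqEcard cards2.
move: yA; rewrite !inE eq_sym => /andP[-> yA]; rewrite A2 andbT.
by apply/subsetP => w; rewrite !inE => /orP[] /eqP->.
Qed.

Lemma set2_eq (S : finType) (x y z w : S) : [set x; y] = [set z; w] ->
  (x = z /\ y = w) \/ (x = w /\ y = z).
Proof.
move=> E.
have: x \in [set z; w] by rewrite -E !inE eqxx.
have: y \in [set z; w] by rewrite -E !inE eqxx orbT.
have: z \in [set x; y] by rewrite E !inE eqxx.
have: w \in [set x; y] by rewrite E !inE eqxx orbT.
by rewrite !inE => /orP[] /eqP? /orP[] /eqP? /orP[] /eqP? /orP[] /eqP?; subst; auto.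
Qed.

(** * Lower bounds on color classes and on the number of colors *)

Section Costs.
Hypothesis n_inj : injective n.
Variables i0 i1 : I.
Hypothesis i01 : i0 != i1.

Let I_gt0 : 0 < #|I|. Proof. by apply/card_gt0P; exists i0. Qed.

Definition zero i : 'I_(n i) := Ordinal (ltn_trans (isT : 0 < 4) (n5 i)).

Let p := point zero.

Lemma nontrivial_automorphism : exists s, automorphism s /\ s <> 1%g.
Proof. by have [s [? _ _ ?]] := swap_automorphism p p I_gt0; exists s. Qed.

Lemma vertex_class_gt2 (c : torus -> 'I_2) (a : 'I_2) :
  vertex_distinguishing c -> 2 < #|[set x | c x == a]|.
Proof.
move=> dist; rewrite ltnNge; apply/negP => /(set_le2 p)[x [y E]].
have [s [auts sx sy]] := swap_automorphism x y I_gt0; apply.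
apply: dist => // z; apply: (@ord2_eq a).
have H w : (c w == a) = (w \in [set x | c x == a]) by rewrite inE.
rewrite !H; case: E => ->; rewrite !inE //.
by rewrite -{1}sy -{2}sx !(inj_eq perm_inj) orbC.
Qed.

(** An empty class is kept by every automorphism, a single edge by the one exchanging its ends. *)
Lemma edge_class_gt1 (c : {set torus} -> 'I_2) (a : 'I_2) :
  edge_distinguishing c -> 1 < #|[set e in edges torus | c e == a]|.
Proof.
move=> dist; rewrite ltnNge leq_eqVlt ltnS leqn0 cards_eq0 orbC; apply/negP.
have H e : e \in edges torus ->
    (c e == a) = (e \in [set e in edges torus | c e == a]).
  by move=> eE; rewrite inE eE.
move=> /orP[/eqP E|/cards1P[e E]].
  have [s [auts]] := nontrivial_automorphism; apply.
  apply: dist => // e eE; apply: (@ord2_eq a).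
  by rewrite !H ?imset_edges // E !inE.
have: e \in edges torus by have := set11 e; rewrite -E inE => /andP[].
move=> /imsetP[[x y] /= _ exy].
have [s [auts sx sy]] := swap_automorphism x y I_gt0; apply.
apply: dist => // f fE; apply: (@ord2_eq a).
have se : s @: e = e by rewrite exy imset2 sx sy setUC.
by rewrite !H ?imset_edges // E !inE -{1}se (inj_eq (imset_inj perm_inj)).
Qed.

Lemma vertex_distinguishing_colors d (c : torus -> 'I_d) :
  vertex_distinguishing c -> 1 < d.
Proof.
move=> dist; rewrite ltnNge; apply/negP => d1.
have [s [auts]] := nontrivial_automorphism; apply.
by apply: dist => // x; apply: ord_lt2_eq.
Qed.

Lemma edge_distinguishing_colors d (c : {set torus} -> 'I_d) :
  edge_distinguishing c -> 1 < d.
Proof.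
move=> dist; rewrite ltnNge; apply/negP => d1.
have [s [auts]] := nontrivial_automorphism; apply.
by apply: dist => // e _; apply: ord_lt2_eq.
Qed.

(** * Three vertices and two edges with trivial stabilizer *)

Let ones := point (fun i => ordS (zero i)).

Lemma ordS_neq m (u : 'I_m) : 5 <= m -> ordS u <> u.
Proof. by move=> m5; apply/eqP; apply: (shift_neq m5 true). Qed.

(** Among the three vertices, only [p] and [q] agree at [i0], and only [q] and [ones] agree at [i1].
    Both pairs are preserved, so all three vertices are fixed, and [p] and [ones] have consecutive
    values in every coordinate. *)
Lemma rigid_vertices s : automorphism s ->
  (forall x, x \in [set p; step true i1 p; ones] ->
             s x \in [set p; step true i1 p; ones]) -> s = 1%g.
Proof.
move=> auts; set q := step true i1 p => H.
have qp : q <> p by apply/eqP; apply: step_neq.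
have q0 : coord q i0 = coord p i0 by rewrite coord_step_out // eq_sym.
have q1 : coord q i1 = coord ones i1 by rewrite coord_step !coord_point.
have on i : coord ones i = ordS (coord p i) by rewrite !coord_point.
have onp i : coord ones i <> coord p i by rewrite on; apply: ordS_neq.
have s0 := aut_coord n_inj auts q0.
have s1 := aut_coord n_inj auts q1.
have pq : s q <> s p by move/perm_inj.
have oq : s ones <> s q by move/perm_inj => E; apply: (onp i0); rewrite E.
have := (H p, H q, H ones); rewrite !inE !eqxx !orbT /=.
move=> [[/(_ isT) Hp /(_ isT) Hq] /(_ isT) Ho].
have [sp so] : s p = p /\ s ones = ones.
  move: Hp Hq Ho s0 s1 pq oq.
  have [N0 N1] := (onp i0, onp i1).
  by case/orP=> [/orP[]|] /eqP->; case/orP=> [/orP[]|] /eqP->;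
    case/orP=> [/orP[]|] /eqP->; split; congruence.
apply/permP => z; rewrite perm1; apply: coord_inj => i.
by apply: (aut_coord_fix n_inj auts (on i)); rewrite ?sp ?so.
Qed.

Let q := step true i0 p.
(** The vertex (2,0,1,...,1), with [i0] and [i1] listed first; the boolean [i != i1] is read as 0 or
    1. *)
Let r := point (fun i => iter (if i == i0 then 2 else i != i1) (@ordS _) (zero i)).
Let t := step true i1 r.

(** The edges have different directions, so neither maps to the other; their relative position then
    forbids flipping either. Consecutive fixed values come from [p], [q] at [i0], from [r], [t] at
    [i1], and from [p], [r] elsewhere. *)
Lemma rigid_edges s : automorphism s ->
  (forall e, e \in [set [set p; q]; [set r; t]] ->
             s @: e \in [set [set p; q]; [set r; t]]) -> s = 1%g.
Proof.
move=> auts H.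
have i10 : i1 != i0 by rewrite eq_sym.
have q0 : coord q i0 = ordS (coord p i0) by rewrite coord_step.
have qj j : i0 != j -> coord q j = coord p j by apply: coord_step_out.
have t1 : coord t i1 = ordS (coord r i1) by rewrite coord_step.
have tj j : i1 != j -> coord t j = coord r j by apply: coord_step_out.
have r0 : coord r i0 = ordS (ordS (coord p i0)) by rewrite !coord_point eqxx.
have r1 : coord r i1 = coord p i1 by rewrite !coord_point (negbTE i10) eqxx.
have rj j : i0 != j -> i1 != j -> coord r j = ordS (coord p j).
  by move=> j0 j1; rewrite !coord_point !(eq_sym j) (negbTE j0) j1.
have sq1 := aut_coord n_inj auts (qj i1 i01).
have st0 := aut_coord n_inj auts (tj i0 i10).
have spq : (s p = p /\ s q = q) \/ (s p = q /\ s q = p).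
  have := H [set p; q]; rewrite !inE eqxx imset2 => /(_ isT) /orP[] /eqP /set2_eq //.
  case=> [[sp sq]|[sp sq]]; move: sq1; rewrite sp sq t1.
    by move/ordS_neq => -/(_ (n5 _)).
  by move/esym/ordS_neq => -/(_ (n5 _)).
have srt : (s r = r /\ s t = t) \/ (s r = t /\ s t = r).
  have := H [set r; t]; rewrite !inE eqxx imset2 orbT => /(_ isT).
  case/orP => /eqP /set2_eq //.
  case=> [[sr st]|[sr st]]; move: st0; rewrite sr st q0.
    by move/ordS_neq => -/(_ (n5 _)).
  by move/esym/ordS_neq => -/(_ (n5 _)).
have spj j : i0 != j -> coord (s p) j = coord p j.
  by move=> j0; case: spq => [] [-> _] //; rewrite qj.
have srj j : i1 != j -> coord (s r) j = coord r j.
  by move=> j1; case: srt => [] [-> _] //; rewrite tj.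
apply/permP => z; rewrite perm1; apply: coord_inj => j.
case: (eqVneq i0 j) => [<-|j0].
  case: spq => [] [sp sq].
    by apply: (aut_coord_fix n_inj auts q0); rewrite ?sp ?sq.
  (* Flipping the first edge would exchange 0 and 1 at [i0], hence send 2 to -1; but [s] keeps the
     value 2 of [r] there, and 2 = -1 would need a cycle of length 3. *)
  have [b E] := aut_coord_shift n_inj auts p i0; exfalso.
  have Eq := E 1 q q0; have := E 2 r r0; rewrite srj // r0.
  move: Eq; rewrite sp sq /= q0; case: b {E} => /=.
    by move=> /esym /(@shift_iter_neq _ (n5 i0) true 2 _ isT).
  move=> _; rewrite ordSK => /(congr1 (@ordS _)); rewrite ord_predK.
  exact: (@shift_iter_neq _ (n5 i0) true 3).
case: (eqVneq i1 j) => [<-|j1].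
  (* [r] agrees with [p] at [i1], where [s p] keeps its value, so the second edge cannot flip. *)
  have sr : s r = r.
    case: srt => [] [sr _] //; have := aut_coord n_inj auts r1.
    by rewrite sr spj // t1 r1 => /ordS_neq -/(_ (n5 _)).
  have st : s t = t.
    by case: srt => [] [_ st] //; apply: (@perm_inj _ s); rewrite st sr.
  by apply: (aut_coord_fix n_inj auts t1); rewrite ?sr ?st.
apply: (aut_coord_fix n_inj auts (rj j j0 j1)); [exact: spj|exact: srj].
Qed.

Lemma distinguishing_vertices : exists2 c : torus -> 'I_2,
  vertex_distinguishing c & #|[set x | c x == ord_max]| <= 3.
Proof.
set S := [set p; step true i1 p; ones].
exists (fun x => if x \in S then ord_max else ord0).
  move=> s auts H; apply: rigid_vertices => // x xS.
  by have := H x; rewrite xS; case: ifP.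
apply: leq_trans (_ : #|S| <= 3).
  by apply: subset_leq_card; apply/subsetP => x; rewrite inE; case: ifP.
by rewrite /S setUC cardsU1 cards2 (@leq_add _ _ 1 2) ?ltnS ?leq_b1.
Qed.

Lemma distinguishing_edges : exists2 c : {set torus} -> 'I_2,
  edge_distinguishing c & #|[set e in edges torus | c e == ord_max]| <= 2.
Proof.
set S := [set [set p; q]; [set r; t]].
exists (fun e => if e \in S then ord_max else ord0).
  move=> s auts H; apply: rigid_edges => // e eS.
  (* Invariance of the coloring is known on edges only, so the members of [S] must be edges. *)
  have eE : e \in edges torus.
    by move: eS; rewrite !inE => /orP[] /eqP->; apply: step_edge.
  by have := H e eE; rewrite -/S eS; case: ifP.
apply: leq_trans (_ : #|S| <= 2).
  by apply: subset_leq_card; apply/subsetP => x; rewrite inE => /andP[_]; case: ifP.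
by rewrite cards2; case: (_ != _).
Qed.

(** * Values of the two costs *)

Lemma torus_rho : is_rho torus 3.
Proof.
have [c dist c3] := distinguishing_vertices.
split; split.
- by exists c.
- by move=> d [c' /vertex_distinguishing_colors].
- exists c => //; apply/eqP; rewrite eqn_leq leq_min !vertex_class_gt2 //=.
  by rewrite geq_min c3 orbT.
by move=> _ [c' dist' ->]; rewrite leq_min !vertex_class_gt2.
Qed.

Lemma torus_rho' : is_rho' torus 2.
Proof.
have [c dist c2] := distinguishing_edges.
split; split.
- by exists c.
- by move=> d [c' /edge_distinguishing_colors].
- exists c => //; apply/eqP; rewrite eqn_leq leq_min !edge_class_gt1 //=.
  by rewrite geq_min c2 orbT.
by move=> _ [c' dist' ->]; rewrite leq_min !edge_class_gt1.
Qed.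

End Costs.

End CycleProduct.

Theorem theorem5p4 (k : nat) (n : 'I_k -> nat) (hk : 2 <= k)
    (hdist : forall i j : 'I_k, i <> j -> n i <> n j)
    (hn : forall i : 'I_k, 5 <= n i) :
  is_rho' (cart_prod (fun i : 'I_k => cycle_graph (n i))) 2 /\
  is_rho (cart_prod (fun i : 'I_k => cycle_graph (n i))) 3.
Proof.
have n_inj : injective n.
  by move=> i j E; case: (eqVneq i j) => // /eqP /hdist.
(* Coordinates 0 and 1 serve as [i0] and [i1]; [2 <= k] unfolds to [1 < k]. *)
have i01 : Ordinal (ltnW hk) != Ordinal hk by [].
split; [exact: torus_rho' i01|exact: torus_rho i01].
Qed.
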